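(* Let $n\ge 9$ be an integer and let $G$ be a connected, non-complete graph of order $n$ with $\delta(G)\ge 2$. If $\sigma_4(G)\ge n$, then $cfc(G)=2$.
   Context: All graphs are finite, without loops or multiple edges; the order of $G$ is $|V(G)|$, $d_G(v)$ is the degree of $v$ in $G$, and $\delta(G)$ is the minimum degree of $G$. $\sigma_4(G)$ is the minimum of $\sum_{s\in S} d_G(s)$ over all independent sets $S\subseteq V(G)$ (no two vertices adjacent) with $|S|=4$; by convention $\sigma_4(G)=+\infty$ if $G$ has no independent set of size $4$. Given an edge-colouring of $G$ (not necessarily proper), a path is conflict-free if some colour appears on exactly one of its edges. An edge-coloured graph is conflict-free connected if every pair of distinct vertices is connected by a conflict-free path. The conflict-free connection number $cfc(G)$ of a connected graph $G$ is the minimum number of colours in an edge-colouring making $G$ conflict-free connected. *)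

(* Defs.v *)
(* Mathematical Components (boolean, finite-type) style. *)
From mathcomp Require Import all_boot.

Set Implicit Arguments.
Unset Strict Implicit.
Unset Printing Implicit Defensive.

Record sgraph := SGraph {
  vertex :> finType;
  adj : rel vertex;
  adj_sym : symmetric adj;
  adj_irrefl : irreflexive adj
}.

Section Graph.
Variable G : sgraph.
Implicit Types (x y : G) (p : seq G) (S : {set G}).

Definition connected_graph : bool := [forall x : G, forall y : G, connect (@adj G) x y].

Definition complete_graph : bool := [forall x : G, forall y : G, (x != y) ==> adj x y].

Definition deg x : nat := #|[set y | adj x y]|.

(* Every degree is smaller than #|G|, so the default value #|G| is irrelevant
   as soon as G has a vertex. *)
Definition min_deg : nat := \big[minn/#|G|]_(x : G) deg x.

Definition independent S : bool := [forall x in S, forall y in S, ~~ adj x y].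

Definition indep_of_size k S : bool := independent S && (#|S| == k).

Definition deg_sum S : nat := \sum_(s in S) deg s.

(* None stands for +oo. *)
Definition sigma k : option nat :=
  omap deg_sum [pick S | indep_of_size k S
    & [forall T, indep_of_size k T ==> (deg_sum S <= deg_sum T)]].

Definition edge_set : {set {set G}} :=
  [set [set xy.1; xy.2] | xy : G * G & adj xy.1 xy.2].

Definition edge : finType := {f : {set G} | f \in edge_set}.

(* The edges of the walk that starts at x and then visits p. *)
Definition walk_edges x p : seq {set G} := pairmap (fun u v => [set u; v]) x p.

Definition conflict_free k (c : {ffun edge -> 'I_k}) x p : bool :=
  [exists a : 'I_k,
     #|[set f : edge | (val f \in walk_edges x p) && (c f == a)]| == 1].

Definition is_path x y p : bool :=
  [&& path (@adj G) x p, last x p == y & uniq (x :: p)].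

(* A path has at most #|G| vertices, so that it is enough to let p range over
   the finite type of sequences of size at most #|G|. *)
Definition cf_connected k (c : {ffun edge -> 'I_k}) : bool :=
  [forall x : G, forall y : G, (x != y) ==>
     [exists p : #|G|.-bseq G, is_path x y p && conflict_free c x p]].

Definition cf_colourable k : bool :=
  [exists c : {ffun edge -> 'I_k}, cf_connected c].

Lemma cf_connectedP k (c : {ffun edge -> 'I_k}) :
  reflect (forall x y, x != y -> exists2 p, is_path x y p & conflict_free c x p)
          (cf_connected c).
Proof.
apply: (iffP forallP) => [H x y xy | H x].
  have /forallP/(_ y)/implyP/(_ xy)/existsP[p /andP[Hp cp]] := H x.
  by exists p.
apply/forallP => y; apply/implyP => /(H x y)[p Hp cp].
have [_ _ Up] := and3P Hp.
have sp : size p <= #|G|.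
  by move/card_uniqP: Up => /= Up; apply: ltnW; rewrite -Up max_card.
by apply/existsP; exists (Bseq sp); rewrite /= Hp cp.
Qed.

(* Giving all the edges different colours works. *)
Lemma cf_colourable_connected :
  connected_graph -> exists k, cf_colourable k.
Proof.
move=> Gconn; exists #|edge|; apply/existsP; exists (finfun enum_rank).
apply/cf_connectedP => x y xy.
have /forallP/(_ x)/forallP/(_ y)/connectP[p0 Hp0 ly] := Gconn.
move: xy; rewrite ly; case/shortenP: Hp0 => p Hp Up _ xy.
exists p; first by rewrite /is_path Hp eqxx Up.
case: p Hp Up xy => [|z p] /=; first by rewrite eqxx.
case/andP=> xz _ _ _.
have Ef : [set x; z] \in edge_set by apply/imsetP; exists (x, z); rewrite ?inE.
pose f0 : edge := Sub [set x; z] Ef.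
apply/existsP; exists (enum_rank f0).
apply/cards1P; exists f0; apply/setP => f.
rewrite !inE ffunE (inj_eq enum_rank_inj).
by case: (f =P f0) => [->|_]; rewrite ?andbF // eqxx.
Qed.

Definition cfc (Gconn : connected_graph) : nat :=
  ex_minn (cf_colourable_connected Gconn).

End Graph.

(* m >= n for m in nat extended with +oo, encoded as None. *)
Definition geq_oo (m : option nat) (n : nat) : bool :=
  if m is Some m' then n <= m' else true.

Lemma sigma_geP (G : sgraph) (k n : nat) :
  reflect (forall S : {set G}, independent S -> #|S| = k ->
             n <= \sum_(s in S) deg s)
          (geq_oo (sigma G k) n).
Proof.
rewrite /sigma; case: pickP => [S /andP[/andP[iS /eqP cS] /forallP minS] | noS].
  apply: (iffP idP) => [leS T iT cT | H]; last exact: H.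
  apply: leq_trans leS _; have /implyP := minS T.
  by apply; rewrite /indep_of_size iT cT eqxx.
apply: ReflectT => S iS cS.
have PS : indep_of_size k S by rewrite /indep_of_size iS cS eqxx.
have := noS [arg min_(T < S | indep_of_size k T) deg_sum T].
case: arg_minnP => // T -> minT /= /negbT/negP[].
by apply/forallP => U; apply/implyP; apply: minT.
Qed.

(* Main.v *)
(* Upper bound.  In every block that is not a bridge give the second colour to
   a single edge uv.  Inside such a block two vertices are joined by a path
   through uv and by a path avoiding uv, so two vertices of G whose joining
   paths leave the bridges at least once have a path with exactly one edge of
   the second colour.  What remains are pairs joined by bridges only; they cause
   no trouble if, after giving the second colour to one more bridge ab, no two
   adjacent bridges both differ from ab.
   Such an ab exists: deleting three bridges leaves four parts.  If the parts
   form a star, three interior vertices of the leaves and the centre have degree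
   sum at most n - 1.  If they form a path, the same count shows that the two
   middle parts are single vertices of degree 2, and ab is the middle bridge. *)
Require Import Defs.
From mathcomp Require Import all_boot zify.

Set Implicit Arguments.
Unset Strict Implicit.
Unset Printing Implicit Defensive.

Section Paths.
Variable G : sgraph.
Implicit Types (x y z u v : G) (p q : seq G) (A B S X Y : {set G}) (f : rel G).

(** * Simple paths inside a vertex set *)

Definition path_in S x y p := is_path x y p && all (mem S) (x :: p).

Lemma path_inP S x y p :
  reflect [/\ path (@adj G) x p, last x p = y, uniq (x :: p) & {subset x :: p <= S}]
          (path_in S x y p).
Proof.
apply: (iffP andP) => [[/and3P[pp /eqP lp up] /allP sp] | [pp lp up sp]].
  by split.
by split; [rewrite /is_path pp lp eqxx up | apply/allP].
Qed.

Lemma path_in_uniq S x y p : path_in S x y p -> x \notin p /\ uniq p.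
Proof. by case/path_inP => _ _ /andP. Qed.

Lemma path_in_nil S x : x \in S -> path_in S x x [::].
Proof.
by move=> xS; apply/path_inP; split=> // a; rewrite inE => /eqP->.
Qed.

Lemma path_in_cons S x y z p :
  x \in S -> adj x y -> x \notin y :: p -> path_in S y z p -> path_in S x z (y :: p).
Proof.
move=> xS xy xp /path_inP[pp lp up sp]; apply/path_inP; split=> //=.
- by rewrite xy.
- by rewrite xp.
- by move=> a; rewrite inE => /predU1P[->|/sp].
Qed.

Lemma path_in_sub S S' x y p : S \subset S' -> path_in S x y p -> path_in S' x y p.
Proof.
move=> /subsetP sS /path_inP[pp lp up sp]; apply/path_inP; split=> // a /sp.
exact: sS.
Qed.

Lemma path_in_cat S x v y p q : path_in S x v p -> path_in S v y q ->
  (forall a, a \in x :: p -> a \in q -> False) -> path_in S x y (p ++ q).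
Proof.
move=> /path_inP[pp lp up sp] /path_inP[pq lq uq sq] dis; apply/path_inP; split.
- by rewrite cat_path pp lp.
- by rewrite last_cat lp.
- rewrite -cat_cons cat_uniq up andTb; case/andP: uq => _ uq; apply/andP; split=> //.
  by apply/hasPn => a aq; apply/negP => /dis/(_ aq).
- move=> a; rewrite -cat_cons mem_cat => /orP[/sp //|aq].
  by apply: sq; rewrite inE aq orbT.
Qed.

Lemma path_in_rev S x y p :
  path_in S x y p -> exists2 q, path_in S y x q & y :: q =i x :: p.
Proof.
move=> /path_inP[pp lp up sp]; exists (rev (belast x p)).
  have E : y :: rev (belast x p) = rev (x :: p).
    by rewrite (lastI x p) rev_rcons lp.
  apply/path_inP; split.
  - rewrite -{1}lp rev_path (eq_path (e' := @adj G)) // => a b.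
    by rewrite adj_sym.
  - by case: p lp {pp up sp E} => [|b p] //= _; rewrite rev_cons last_rcons.
  - by rewrite E rev_uniq.
  - by move=> a; rewrite E mem_rev => /sp.
by move=> a; rewrite (_ : y :: _ = rev (x :: p)) ?mem_rev // (lastI x p) rev_rcons lp.
Qed.

Lemma path_in_suffix S x c y p1 p2 :
  path_in S x y (p1 ++ c :: p2) -> path_in S c y p2.
Proof.
move=> /path_inP[]; rewrite cat_path last_cat /= mem_cat cat_uniq /=.
move=> /and3P[_ _ pp] lp /and5P[_ _ _ cp up] sp; apply/path_inP; split=> //=.
  by rewrite cp.
by move=> a ap; apply: sp; rewrite inE mem_cat ap !orbT.
Qed.

(** The path is cut off at its first vertex satisfying [P]; the induction stops as soon as the
    current start satisfies [P], so on the prefix only the last vertex does. *)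
Lemma first_hit S (P : pred G) x y p : path_in S x y p -> P y ->
  exists c q, [/\ path_in S x c q, P c, {subset q <= p}
                & {in x :: q, forall a, P a -> a = c}].
Proof.
elim: p x => [|b p IHp] x /path_inP[pp lp up sp] Py.
  exists x, [::]; split=> //; last by move=> a; rewrite inE => /eqP.
    by apply: path_in_nil; apply: sp; rewrite inE.
  by rewrite -lp in Py.
have xS : x \in S by apply: sp; rewrite inE eqxx.
have [Px|nPx] := boolP (P x).
  exists x, [::]; split=> //; first exact: path_in_nil.
  by move=> a; rewrite inE => /eqP.
case/andP: pp => xb pp; case/andP: up => xnp up.
have pb : path_in S b y p.
  by apply/path_inP; split=> // a ap; apply: sp; rewrite inE ap orbT.
have [c [q [pq Pc sq hq]]] := IHp _ pb Py.
have xq : x \notin b :: q.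
  apply: contra xnp; rewrite !inE => /orP[->//|/sq->]; exact: orbT.
exists c, (b :: q); split=> //; first exact: path_in_cons.
  by move=> a; rewrite !inE => /orP[->//|/sq->]; exact: orbT.
move=> a; rewrite inE => /predU1P[->|]; first by rewrite (negPf nPx).
exact: hq.
Qed.

Definition edge_in S : rel G := [rel x y | [&& x \in S, y \in S & adj x y]].

Definition connected_in S := [forall x in S, forall y in S, connect (edge_in S) x y].

Lemma connected_inP S :
  reflect {in S &, forall x y, connect (edge_in S) x y} (connected_in S).
Proof.
apply: (iffP forall_inP) => [H x y xS yS | H x xS].
  by have /forall_inP/(_ y yS) := H x xS.
by apply/forall_inP => y; apply: H.
Qed.

Lemma connect_path_in S x y :
  x \in S -> connect (edge_in S) x y -> exists p, path_in S x y p.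
Proof.
move=> xS /connectP[p0 pp0 ->]; case/shortenP: pp0 => p pp up _; exists p.
apply/path_inP; split=> //.
  by apply: sub_path pp => a b /and3P[].
elim: p x xS pp {up} => [|b p IHp] x xS /=.
  by move=> _ a; rewrite inE => /eqP->.
case/andP => /and3P[_ bS _] /(IHp _ bS) sp a.
by rewrite inE => /predU1P[->|/sp].
Qed.

Lemma connect_edge_in_sym S : connect_sym (edge_in S).
Proof.
by apply: sym_connect_sym => a b; rewrite /edge_in /= adj_sym andbCA.
Qed.

(** * Disjoint paths to the ends of an edge *)

Definition fan S u v z := exists p q,
  [/\ path_in S z u p, path_in S z v q & forall a, a \in z :: p -> a \in q -> False].

(** When [u] and [v] are adjacent, the two disjoint paths and the edge [uv] together form a simple
    path from [y] to [z] through [uv]. *)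
Definition link S u v y z := exists p q,
  [/\ path_in S y u p, path_in S z v q
    & forall a, a \in y :: p -> a \in z :: q -> False].

Lemma fan_sym S u v z : fan S u v z -> fan S v u z.
Proof.
move=> [p [q [pp pq dis]]]; exists q, p; split=> // a.
have [zp _] := path_in_uniq pp.
rewrite inE => /predU1P[->|aq ap]; first by apply/negP.
by apply: (dis a) => //; rewrite inE ap orbT.
Qed.

(** From [y] follow [r] to [c], then the rest of [p] to [u]; the branch [q] from [z] to [v] stays
    untouched. The two are disjoint because [r] avoids [z] and meets the fan only in [c], which lies
    on the other branch. *)
Lemma fan_link_hit S u v z p q y c r :
  path_in S z u p -> path_in S z v q ->
  (forall a, a \in z :: p -> a \in q -> False) ->
  path_in (S :\ z) y c r -> c \in p ->
  {in y :: r, forall a, a \in p ++ q -> a = c} -> link S u v y z.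
Proof.
move=> pp pq dis pr cp hit.
have [zp up] := path_in_uniq pp.
have [_ _ _ sr] := path_inP _ _ _ _ pr.
case/splitPr: cp pp dis hit zp up => p1 p2 pp dis hit zp up.
have cp2 : c \notin p2 by move: up; rewrite cat_uniq /= => /and4P[].
exists (r ++ p2), q; split=> //.
  apply: path_in_cat (path_in_sub (subsetDl _ _) pr) (path_in_suffix pp) _.
  move=> a ar ap; move/negP: cp2; apply; rewrite -(hit a ar) //.
  by rewrite !mem_cat inE ap !orbT.
move=> a; rewrite -cat_cons mem_cat => /orP[ar|ap].
  rewrite inE => /predU1P[az|aq].
    by have := sr a ar; rewrite az !inE eqxx.
  have ac : a = c by apply: hit => //; rewrite mem_cat aq orbT.
  by apply: (dis a) => //; rewrite ac !(inE, mem_cat) eqxx !orbT.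
rewrite inE => /predU1P[az|aq].
  by move/negP: zp; apply; rewrite -az mem_cat inE ap !orbT.
by apply: (dis a) => //; rewrite !(inE, mem_cat) ap !orbT.
Qed.

Section NoCutVertex.
Variables (S : {set G}) (u v : G).
Hypotheses (uS : u \in S) (vS : v \in S) (uv : adj u v).
Hypothesis S_conn : connected_in S.
Hypothesis S_cut : forall z, z \in S -> connected_in (S :\ z).

Lemma adj_neq x y : adj x y -> x != y.
Proof. by apply: contraTneq => ->; rewrite adj_irrefl. Qed.

(* Follow a path from y to {u, v} that avoids z up to its first vertex on the
   fan, and then the fan to u or v. *)
Lemma fan_link y z : y \in S -> z \in S -> y != z -> fan S u v z ->
  link S u v y z \/ link S v u y z.
Proof.
move=> yS zS yz fz.
(* At least one end of [uv] differs from [z]. It lies on the fan, so a path towards it that avoids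
   [z] must hit one of the branches. *)
have [c0 c0S [c0z c0uv]] : exists2 c0, c0 \in S & c0 != z /\ (c0 == u) || (c0 == v).
  have [uz|uz] := eqVneq u z.
    by exists v => //; rewrite eqxx orbT -uz eq_sym adj_neq.
  by exists u => //; rewrite eqxx.
have [p [q [pp pq dis]]] := fz.
have yz' : y \in S :\ z by rewrite !inE yz.
have [|r0 pr0] := @connect_path_in (S :\ z) y c0 yz'.
  by apply: (connected_inP _ (S_cut zS)); rewrite // !inE c0z.
have c0pq : c0 \in p ++ q.
  have : c0 \in (z :: p) ++ (z :: q).
    have [_ lp _ _] := path_inP _ _ _ _ pp; have [_ lq _ _] := path_inP _ _ _ _ pq.
    rewrite mem_cat; apply/orP; case/orP: c0uv => /eqP->; [left|right].
      by rewrite -{1}lp mem_last.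
    by rewrite -{1}lq mem_last.
  by rewrite !(inE, mem_cat) (negPf c0z).
have [c [r [pr cpq _ hit]]] := first_hit (P := fun a => a \in p ++ q) pr0 c0pq.
move: (cpq); rewrite mem_cat => /orP[cp|cq].
  by left; apply: fan_link_hit pp pq dis pr cp hit.
right; apply: (@fan_link_hit S v u z q p y c r) => // a.
  rewrite inE => /predU1P[->|aq ap].
    by have [/negP] := path_in_uniq pp.
  by apply: (dis a) => //; rewrite inE ap orbT.
by move=> ar; rewrite mem_cat orbC -mem_cat; apply: hit.
Qed.

(** Putting the edge from [b] to [w] in front of the path of [w] makes both paths start at [b], and
    they still share no other vertex. *)
Lemma link_fan u' v' w b : w \in S -> adj w b -> link S u' v' b w -> fan S u' v' b.
Proof.
move=> wS wb [p [q [pp pq dis]]]; exists p, (w :: q); split=> //.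
have [_ _ _ sp] := path_inP _ _ _ _ pp.
apply: path_in_cons pq; rewrite 1?adj_sym //; first by apply: sp; rewrite inE eqxx.
by apply/negP; apply: dis; rewrite inE eqxx.
Qed.

(** The fan is carried along a walk from [u] to [z]. At [u] it consists of the empty path and the
    edge [uv]; a step from [w] to [b] uses [fan_link] and then [link_fan]. *)
Lemma fanT z : z \in S -> fan S u v z.
Proof.
move=> zS; have /connectP[p pp lp] := connected_inP _ S_conn u z uS zS.
have fu : fan S u v u.
  exists [::], [:: v]; split; first exact: path_in_nil.
    apply: path_in_cons => //; last exact: path_in_nil.
    by rewrite inE adj_neq.
  move=> a; rewrite !inE => /eqP-> /eqP uv'.
  by have := adj_neq uv; rewrite uv' eqxx.
(* Only the start of the walk is generalised; the [u] in which a branch of the fan ends stays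
   fixed. *)
elim: p {2 3 4}u fu pp lp => [|b p IHp] w fw /=; first by move=> _ ->.
case/andP => /and3P[wS bS wb] pp lp; apply: IHp pp lp.
have bw : b != w by rewrite eq_sym adj_neq.
have [l|l] := fan_link bS wS bw fw; first exact: link_fan wS wb l.
apply: fan_sym; exact: link_fan wS wb l.
Qed.

End NoCutVertex.

(** * Routes and cuts *)

Definition count_edges f x p := count id (pairmap f x p).

Lemma count_edges_cat f x p q :
  count_edges f x (p ++ q) = count_edges f x p + count_edges f (last x p) q.
Proof. by rewrite /count_edges pairmap_cat count_cat. Qed.

Lemma count_edges_leq S f f' x y p : path_in S x y p ->
  {in S &, forall a b, adj a b -> f a b -> f' a b} ->
  count_edges f x p <= count_edges f' x p.
Proof.
move=> /path_inP[pp _ _ sp] ff'; rewrite /count_edges.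
elim: p x pp sp => //= b p IHp x /andP[xb pp] sp; apply: leq_add.
  case fxb: (f x b) => //; rewrite ff' //; apply: sp; by rewrite !inE eqxx ?orbT.
by apply: IHp pp _ => a ap; apply: sp; rewrite inE ap orbT.
Qed.

(** Two instances matter: for [k = 1] with [f] the second colour this is a conflict-free path, and
    for [k = 0] with [f] the relation [nonbridge] it is a path made of bridges only. *)
Definition route S f k x y := exists2 p, path_in S x y p & count_edges f x p = k.

Lemma route_sub S S' f k x y : S \subset S' -> route S f k x y -> route S' f k x y.
Proof. by move=> sS [p pp cp]; exists p => //; apply: path_in_sub pp. Qed.

Lemma route_eq S f f' k x y : {in S &, forall a b, adj a b -> f a b = f' a b} ->
  route S f k x y -> route S f' k x y.
Proof.
move=> ff' [p pp cp]; exists p => //; rewrite -cp; apply/eqP; rewrite eqn_leq.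
by rewrite !(count_edges_leq pp) // => a b aS bS ab; rewrite ff'.
Qed.

Lemma route0_mono S f f' x y : {in S &, forall a b, adj a b -> f' a b -> f a b} ->
  route S f 0 x y -> route S f' 0 x y.
Proof.
move=> ff' [p pp cp]; exists p => //; apply/eqP; rewrite -leqn0 -cp.
exact: count_edges_leq pp _.
Qed.

Lemma route_glue A B f i j x v y : (forall a, a \in A -> a \in B -> a = v) ->
  route A f i x v -> route B f j v y -> route (A :|: B) f (i + j) x y.
Proof.
move=> AB [p pp cp] [q pq cq]; exists (p ++ q).
  apply: path_in_cat (path_in_sub (subsetUl _ _) pp) (path_in_sub (subsetUr _ _) pq) _.
  move=> a ap aq; have [vq _] := path_in_uniq pq.
  have [_ _ _ sp] := path_inP _ _ _ _ pp; have [_ _ _ sq] := path_inP _ _ _ _ pq.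
  by move/negP: vq; apply; rewrite -(AB a) // ?sp // sq // inE aq orbT.
have [_ lp _ _] := path_inP _ _ _ _ pp.
by rewrite count_edges_cat lp cp cq.
Qed.

(** Reachability after deleting the marked edges; it is transitive, so detours can be substituted
    without caring about repeated vertices. *)
Lemma route0P S f x y : x \in S ->
  route S f 0 x y <-> connect [rel a b | edge_in S a b && ~~ f a b] x y.
Proof.
move=> xS; split=> [[p /path_inP[pp lp _ sp]]|/connectP[p0 pp0 ->]].
  move=> cp; apply/connectP; exists p => //.
  elim: p x {xS} pp {lp} sp cp => //= b p IHp x /andP[xb pp] sp.
  rewrite /count_edges /= => /eqP; rewrite addn_eq0 eqb0 => /andP[-> /eqP cp].
  rewrite /edge_in /= xb !sp ?inE ?eqxx ?orbT //=; apply: IHp => // a ap.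
  by apply: sp; rewrite inE ap orbT.
case/shortenP: pp0 => p pp up _; exists p.
  apply/path_inP; split=> //; first by apply: sub_path pp => a b /andP[/and3P[]].
  elim: p x xS pp {up} => [|b p IHp] x xS /=; first by move=> _ a; rewrite inE => /eqP->.
  case/andP => /andP[/and3P[_ bS _] _] /(IHp _ bS) sp a.
  by rewrite inE => /predU1P[->|/sp].
elim: p x {xS} pp {up} => //= b p IHp x /andP[/andP[_ /negPf nf] pp].
by rewrite /count_edges /= nf; apply: IHp.
Qed.

(** * Cuts, bridges and selections of edges *)

Definition cut S X x y :=
  [&& x \in S :&: X, y \in S :\: X, adj x y
    & [forall a in S :&: X, forall b in S :\: X, adj a b ==> ((a, b) == (x, y))]].

Lemma cutP S X x y :
  reflect [/\ x \in S :&: X, y \in S :\: X, adj x y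
    & forall a b, a \in S -> a \in X -> b \in S -> b \notin X -> adj a b ->
        a = x /\ b = y]
    (cut S X x y).
Proof.
apply: (iffP and4P) => [[xX yX xy /forall_inP H] | [xX yX xy H]]; split=> //.
  move=> a b aS aX bS bX ab; have aSX : a \in S :&: X by rewrite inE aS.
  have /forall_inP/(_ b) := H a aSX; rewrite inE bS bX => /(_ isT).
  by rewrite ab => /eqP[].
apply/forall_inP => a; rewrite inE => /andP[aS aX]; apply/forall_inP => b.
rewrite inE => /andP[bX bS]; apply/implyP => ab.
by have [-> ->] := H a b aS aX bS bX ab.
Qed.

(** A bridge of [G[S]] is described as the only edge across some bipartition of [S]. The witness [X]
    is then at hand as one of the sides. *)
Definition bridge S : rel G := fun x y => [exists X, cut S X x y].

Definition nonbridge S : rel G := fun x y => ~~ bridge S x y.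

Definition attached_at S X v :=
  forall a b, a \in X -> b \in S -> b \notin X -> adj a b -> a = v.

Lemma bridge_attached S A v x y :
  A \subset S -> attached_at S A v -> bridge A x y -> bridge S x y.
Proof.
move=> /subsetP AS Av /existsP[X /cutP[]]; rewrite !inE.
move=> /andP[xA xX] /andP[yX yA] xy H; apply/existsP.
(* All vertices outside [A] go to the side of [v], since the edges leaving [A] all start at [v].
   Thus no new edge crosses the cut. *)
exists (if v \in X then X :|: ~: A else X :&: A).
apply/cutP; case: ifPn => vX; rewrite !inE ?xA ?yA ?AS ?xX ?(negPf yX) //.
  split=> // a b aS; rewrite !inE => aX bS; rewrite negb_or negbK => /andP[bX bA] ab.
  have aA : a \in A.
    apply/negPn/negP => aA; move/negP: bX; apply.
    by rewrite (Av b a) // adj_sym.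
  by apply: H => //; move: aX; rewrite aA orbF.
split=> // a b aS; rewrite !inE => /andP[aX aA] bS bXA ab.
have bA : b \in A.
  by apply/negPn/negP => bA; rewrite -(Av a b) ?aX in vX.
by apply: H => //; move: bXA; rewrite bA andbT.
Qed.

(** A walk in [S] from a vertex of [A] to [v] cannot leave [A] before it has reached [v]. *)
Lemma connected_attached S A v :
  A \subset S -> v \in A -> attached_at S A v -> connected_in S -> connected_in A.
Proof.
move=> /subsetP AS vA Av Sc.
suff Hv x : x \in A -> connect (edge_in A) x v.
  apply/connected_inP => x y xA yA; apply: connect_trans (Hv x xA) _.
  by rewrite connect_edge_in_sym Hv.
move=> xA; have /connectP[p pp lp] := connected_inP _ Sc x v (AS _ xA) (AS _ vA).
elim: p x xA pp lp => [|b p IHp] x xA /=; first by move=> _ ->.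
case/andP=> /and3P[xS bS xb] pp lp; have [->|xv] := eqVneq x v; first exact: connect0.
have bA : b \in A by apply/negPn/negP => bA; rewrite (Av x b) ?eqxx in xv.
by apply: connect_trans (connect1 _) (IHp b bA pp lp); rewrite /edge_in /= xA bA.
Qed.

(* [f] plays the role of the second colour: it has one edge in each block of
   [G[S]] that is not a bridge. *)
Definition selection S f :=
  [/\ symmetric f, forall a b, f a b -> a \in S /\ b \in S,
      {in S &, forall x y, route S f 0 x y}
    & {in S &, forall x y, x != y ->
         route S f 1 x y \/ route S (nonbridge S) 0 x y}].

(** Vertices in different pieces are joined through [v]. A route with one marked edge in one piece
    continues by an unmarked route in the other; if neither piece offers one, two routes of bridges
    are concatenated. *)
Lemma selection_glue A B v fA fB : v \in A -> v \in B ->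
  (forall a, a \in A -> a \in B -> a = v) ->
  attached_at (A :|: B) A v -> attached_at (A :|: B) B v ->
  selection A fA -> selection B fB ->
  selection (A :|: B) [rel a b | fA a b || fB a b].
Proof.
set f := [rel a b | _]; pose S := A :|: B.
move=> vA vB AB attA attB selA selB.
have piece (C : {set G}) fC : v \in C -> C \subset S -> attached_at S C v ->
    selection C fC ->
    {in C &, forall a b, adj a b -> fC a b = f a b} ->
    {in C &, forall x y, route C f 0 x y} /\
    {in C &, forall x y, x != y -> route C f 1 x y \/ route C (nonbridge S) 0 x y}.
  move=> vC CS att [_ _ f0 f1] ff; split=> x y xC yC.
    by apply: route_eq ff _; apply: f0.
  move=> xy; have [r|r] := f1 x y xC yC xy; first by left; apply: route_eq r.
  right; apply: route0_mono r => a b _ _ _; apply: contra.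
  exact: bridge_attached CS att.
have [symA supA _ _] := selA; have [symB supB _ _] := selB.
(* The pieces share a single vertex, hence no edge, so adding the marks of one piece changes nothing
   on the edges of the other. *)
have noadj a b : a \in A -> a \in B -> b \in A -> b \in B -> ~~ adj a b.
  by move=> aA aB bA bB; rewrite (AB a) // (AB b) // adj_irrefl.
have [|a b aA bA ab|A0 A1] := piece A fA vA _ attA selA.
- exact: subsetUl.
- rewrite /f /=; case fBab: (fB a b); rewrite ?orbF //.
  by have [aB bB] := supB _ _ fBab; have := noadj _ _ aA aB bA bB; rewrite ab.
have [|a b aB bB ab|B0 B1] := piece B fB vB _ attB selB.
- exact: subsetUr.
- rewrite /f /=; case fAab: (fA a b) => //=.
  by have [aA bA] := supA _ _ fAab; have := noadj _ _ aA aB bA bB; rewrite ab.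
have cross (C D : {set G}) : v \in C -> v \in D ->
    (forall a, a \in C -> a \in D -> a = v) ->
    {in C &, forall x y, route C f 0 x y} -> {in D &, forall x y, route D f 0 x y} ->
    {in C &, forall x y, x != y -> route C f 1 x y \/ route C (nonbridge S) 0 x y} ->
    {in D &, forall x y, x != y -> route D f 1 x y \/ route D (nonbridge S) 0 x y} ->
    forall x y, x \in C -> y \in C :|: D -> route (C :|: D) f 0 x y /\
    (x != y -> route (C :|: D) f 1 x y \/ route (C :|: D) (nonbridge S) 0 x y).
  move=> vC vD CD C0 D0 C1 D1 x y xC; rewrite inE.
  have subC := subsetUl C D; have subD := subsetUr C D.
  have [yC _|yC /= yD] := boolP (y \in C).
    split; first exact: route_sub (C0 _ _ xC yC).
    by move=> /(C1 _ _ xC yC)[]r; [left|right]; apply: route_sub r.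
  have vy : v != y by apply: contraNneq yC => <-.
  split; first exact: route_glue CD (C0 _ _ xC vC) (D0 _ _ vD yD).
  have [->|xv] := eqVneq x v.
    by move=> /(D1 _ _ vD yD)[]r; [left|right]; apply: route_sub r.
  have [r _|r _] := C1 _ _ xC vC xv.
    by left; apply: route_glue CD r (D0 _ _ vD yD).
  have [r'|r'] := D1 _ _ vD yD vy.
    by left; apply: route_glue CD (C0 _ _ xC vC) r'.
  by right; apply: route_glue CD r r'.
have BA a : a \in B -> a \in A -> a = v by move=> aB aA; apply: AB.
have all x y : x \in S -> y \in S -> route S f 0 x y /\
    (x != y -> route S f 1 x y \/ route S (nonbridge S) 0 x y).
  rewrite {1}/S inE => /orP[xA|xB] yS; first exact: cross.
  by rewrite {1 2 3}/S setUC; apply: cross; rewrite // setUC.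
split.
- by move=> a b; rewrite /f /= symA symB.
- by move=> a b /orP[/supA|/supB][aS bS]; rewrite !inE aS bS ?orbT.
- by move=> x y xS yS; have [] := all x y xS yS.
- by move=> x y xS yS; have [] := all x y xS yS.
Qed.

(** The only possible edge is a bridge of [S], so nothing has to be marked. *)
Lemma selection_small S : connected_in S -> #|S| <= 2 -> selection S [rel x y | false].
Proof.
move=> Sc S2; split=> // x y xS yS.
  apply/(route0P _ _ xS); apply: connect_sub (connected_inP _ Sc x y xS yS) => a b ab.
  by apply: connect1; rewrite /= ab.
move=> xy; right.
have SE z : z \in S -> z != x -> z = y.
  move=> zS zx; apply/eqP/negPn/negP => zy; move: S2; rewrite leqNgt => /negP[].
  have : #|[set x; y; z]| <= #|S|.
    by apply/subset_leq_card/subsetP => a; rewrite !inE -orbA => /or3P[]/eqP->.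
  apply: leq_trans; rewrite -setUA cardsU1 cards2 !inE.
  by rewrite (negPf xy) (eq_sym x z) (negPf zx) (eq_sym y z) zy.
have xy' : adj x y.
  have /connectP[[|b p] /= pp lp] := connected_inP _ Sc x y xS yS.
    by rewrite lp eqxx in xy.
  case/andP: pp => /and3P[_ bS xb] _.
  by rewrite -(SE b) // eq_sym adj_neq.
have brxy : bridge S x y.
  apply/existsP; exists [set x]; apply/cutP; rewrite !inE xS yS eqxx eq_sym xy.
  split=> // a b _; rewrite !inE => /eqP-> bS bx _; split=> //; exact: SE.
exists [:: y].
  by apply: path_in_cons; rewrite ?inE //; apply: path_in_nil.
by rewrite /count_edges /= /nonbridge brxy.
Qed.

Definition same_edge u v : rel G :=
  [rel a b | (a == u) && (b == v) || (a == v) && (b == u)].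

Lemma count_same_edge0 u v x p : (u \notin x :: p) || (v \notin x :: p) ->
  count_edges (same_edge u v) x p = 0.
Proof.
rewrite /count_edges; elim: p x => //= b p IHp x H.
rewrite IHp ?addn0; last first.
  by case/orP: H; rewrite inE negb_or => /andP[_ ->]; rewrite ?orbT.
apply/eqP; rewrite eqb0; apply: contraL H.
by case/orP => /andP[/eqP-> /eqP->]; rewrite !inE !eqxx ?orbT.
Qed.

(** An arbitrary edge [uv] is marked. Links give paths through it, and a fan from a third vertex
    gives a way around it. *)
Lemma selection_nocut S : connected_in S -> 2 < #|S| ->
  (forall z, z \in S -> connected_in (S :\ z)) -> exists f, selection S f.
Proof.
move=> Sc S3 Scut.
have /card_gt0P[u uS] : 0 < #|S| by apply: leq_trans S3.
have /card_gt0P[u' ] : 0 < #|S :\ u|.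
  by move: S3; rewrite (cardsD1 u) uS; case: #|_|.
rewrite !inE => /andP[u'u u'S].
have [v vS uv] : exists2 v, v \in S & adj u v.
  have /connectP[[|b p] /= pp lp] := connected_inP _ Sc u u' uS u'S.
    by rewrite lp eqxx in u'u.
  by case/andP: pp => /and3P[_ bS ub] _; exists b.
have [w wS [wu wv]] : exists2 w, w \in S & w != u /\ w != v.
  have /card_gt0P[w] : 0 < #|S :\: [set u; v]|.
    rewrite cardsD subn_gt0; apply: leq_ltn_trans (subset_leq_card (subsetIr _ _)) _.
    by rewrite cards2; apply: leq_trans S3; case: (u != v).
  by rewrite !inE negb_or => /andP[/andP[wu wv] wS]; exists w.
pose f := same_edge u v.
have symf : symmetric f.
  by move=> a b; rewrite /f /same_edge /= orbC ![(a == _) && _]andbC.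
(* The branches of the fan at [w] lead to [u] without meeting [v], and to [v] without meeting [u];
   together they bypass the edge [uv]. *)
have uvf : connect [rel a b | edge_in S a b && ~~ f a b] u v.
  have [p [q [pp pq dis]]] := fanT uS vS uv Sc Scut wS.
  have [_ lp _ _] := path_inP _ _ _ _ pp; have [_ lq _ _] := path_inP _ _ _ _ pq.
  have wu' : connect [rel a b | edge_in S a b && ~~ f a b] w u.
    apply/(route0P _ _ wS); exists p => //; apply: count_same_edge0.
    apply/orP; right; apply/negP => vp; apply: (dis v) => //.
    by have := mem_last w q; rewrite lq inE eq_sym (negPf wv).
  have wv' : connect [rel a b | edge_in S a b && ~~ f a b] w v.
    apply/(route0P _ _ wS); exists q => //; apply: count_same_edge0.
    apply/orP; left; rewrite inE eq_sym (negPf wu) /=; apply/negP => uq.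
    by apply: (dis u) => //; rewrite -lp mem_last.
  apply: connect_trans _ wv'; rewrite sym_connect_sym // => a b.
  by rewrite /edge_in /= symf adj_sym andbCA.
exists f; split=> //.
- by move=> a b /orP[]/andP[/eqP-> /eqP->].
- move=> x y xS yS; apply/(route0P _ _ xS).
  apply: connect_sub (connected_inP _ Sc x y xS yS) => a b ab.
  have [|nf] := boolP (f a b); last by apply: connect1; rewrite /= ab.
  case/orP => /andP[/eqP-> /eqP->] //.
  rewrite sym_connect_sym //.
  by move=> c d; rewrite /edge_in /= symf adj_sym andbCA.
move=> x y xS yS xy; left.
(* The path goes from [x] to [b], over the marked edge to [c], and then back along the other path of
   the link to [y]. Each of the two outer parts misses an end of [uv], so it has no marked edge. *)
have through b c : b \in S -> c \in S -> adj b c -> same_edge b c =2 f ->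
    link S b c x y -> route S f 1 x y.
  move=> bS cS bc ff [p [q [pp pq dis]]].
  have [q' pq' eqq'] := path_in_rev pq.
  have [_ lp _ sp] := path_inP _ _ _ _ pp; have [_ lq _ _] := path_inP _ _ _ _ pq.
  have bp : b \in x :: p by rewrite -lp mem_last.
  have cq : c \in y :: q by rewrite -lq mem_last.
  exists (p ++ c :: q').
    apply: path_in_cat pp _ _.
      apply: path_in_cons pq' => //; rewrite eqq'; apply/negP; exact: dis.
    by move=> a ap; rewrite eqq'; apply: dis.
  have fbc : f b c by rewrite -ff /same_edge /= !eqxx.
  rewrite count_edges_cat lp (_ : count_edges f b _ = f b c + count_edges f c q') // fbc.
  have cnt z r : count_edges f z r = count_edges (same_edge b c) z r.
    by rewrite /count_edges; elim: r z => //= d r IHr z; rewrite IHr ff.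
  rewrite !cnt !count_same_edge0 //.
    by apply/orP; left; apply/negP; rewrite eqq'; apply: dis.
  by apply/orP; right; apply/negP => /dis; apply.
have [l|l] := fan_link uS vS uv Scut xS yS xy (fanT uS vS uv Sc Scut yS).
  exact: through l.
apply: through l; rewrite 1?adj_sym // => a b.
by rewrite /f /same_edge /= orbC.
Qed.

(** Strong induction on the size of [S]: a cut vertex splits [S] into two smaller connected pieces
    sharing that vertex, to which [selection_glue] applies. *)
Lemma selection_exists S : connected_in S -> exists f, selection S f.
Proof.
have [n] := ubnP #|S|; elim: n S => // n IHn S Sn Sc.
have [/exists_inP[v vS nc] | noC] := boolP [exists v in S, ~~ connected_in (S :\ v)].
  have [a aS [b bS nab]] : exists2 a, a \in S :\ v & exists2 b, b \in S :\ v
      & ~~ connect (edge_in (S :\ v)) a b.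
    by move: nc => /forall_inPn[a aS /forall_inPn[b bS nab]]; exists a => //; exists b.
  (* [C] is a component of [S] without [v]. Both [C] with [v] added and [S] without [C] are attached
     at [v]; the first misses [b], the second misses [a]. *)
  pose C := [set z in S :\ v | connect (edge_in (S :\ v)) a z].
  pose A := v |: C; pose B := S :\: C.
  have vC : v \notin C by rewrite !inE eqxx.
  have [av aS'] := setD1P aS; have [bv bS'] := setD1P bS.
  have aC : a \in C by rewrite inE aS connect0.
  have bC : b \notin C by rewrite inE (negPf nab) andbF.
  have CS z : z \in C -> z \in S by rewrite !inE => /andP[/andP[]].
  have vA : v \in A by rewrite !inE eqxx.
  have vB : v \in B by rewrite inE vC.
  have ABS : A :|: B = S.
    apply/setP => z; rewrite !in_setU in_set1 in_setD.
    case zC: (z \in C) => /=; first by rewrite orbT CS.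
    by rewrite orbF; case: eqP => [->|].
  have subA : A \subset S by rewrite -ABS subsetUl.
  have subB : B \subset S by rewrite -ABS subsetUr.
  have stepC c d : c \in C -> d \in S -> adj c d -> d != v -> d \in C.
    rewrite !inE => /andP[/andP[cv cS] ac] dS cd dv; rewrite dv dS /=.
    by apply: connect_trans ac (connect1 _); rewrite /edge_in /= !inE cv cS dv dS.
  have attA : attached_at S A v.
    move=> c d; rewrite in_setU1 => /predU1P[-> //|cC] dS.
    rewrite in_setU1 negb_or => /andP[dv /negP dC] cd.
    by case: dC; apply: stepC cd dv.
  have attB : attached_at S B v.
    move=> c d; rewrite inE => /andP[cC cS] dS; rewrite inE dS andbT negbK => dC cd.
    by apply/eqP; apply: contraNT cC; apply: stepC dC _ _; rewrite // adj_sym.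
  have Ac := connected_attached subA vA attA Sc.
  have Bc := connected_attached subB vB attB Sc.
  have [|fA selA] := IHn A _ Ac.
    suff ltS : A \proper S by apply: leq_trans (proper_card ltS) Sn.
    apply/properP; split=> //.
    by exists b => //; rewrite in_setU1 negb_or bv.
  have [|fB selB] := IHn B _ Bc.
    suff ltS : B \proper S by apply: leq_trans (proper_card ltS) Sn.
    apply/properP; split=> //.
    by exists a => //; rewrite inE aC.
  have sel := @selection_glue A B v fA fB vA vB; rewrite ABS in sel.
  eexists; apply: sel attA attB selA selB => c; rewrite in_setU1 => /predU1P[-> //|cC].
  by rewrite inE cC.
have [S2|S2] := leqP #|S| 2.
  by exists [rel x y | false]; apply: selection_small.
apply: selection_nocut => // z zS; apply/negPn/negP => nc.
by move/negP: noC; apply; apply/exists_inP; exists z.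
Qed.

(** * Bridges and the degree condition *)

Definition cutT X x y := cut [set: G] X x y.

Lemma cutTP X x y :
  reflect [/\ x \in X, y \notin X, adj x y
    & forall a b, a \in X -> b \notin X -> adj a b -> a = x /\ b = y]
    (cutT X x y).
Proof.
apply: (iffP (cutP _ _ _ _)); rewrite !inE ?andbT /= => -[-> -> -> H]; split=> // a b.
  by move=> aX bX; apply: H.
by move=> _ aX _; apply: H.
Qed.

Lemma cutT_compl X x y : cutT X x y -> cutT (~: X) y x.
Proof.
move=> /cutTP[xX yX xy H]; apply/cutTP; rewrite !inE negbK adj_sym; split=> // a b.
by rewrite !inE negbK adj_sym => aX bX ab; have [] := H b a bX aX ab.
Qed.

Notation bridgeT := (bridge [set: G]).

Lemma bridgeT_sym : symmetric bridgeT.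
Proof.
by move=> x y; apply/existsP/existsP => -[X /cutT_compl cX]; exists (~: X).
Qed.

Lemma bridgeT_adj x y : bridgeT x y -> adj x y.
Proof. by case/existsP => X /cutTP[]. Qed.

Lemma cutT_side X x y a b :
  cutT X x y -> adj a b -> ~~ same_edge x y a b -> (a \in X) = (b \in X).
Proof.
move=> /cutTP[_ _ _ H] ab; rewrite /same_edge /=.
have [aX|aX] := boolP (a \in X); have [bX|bX] := boolP (b \in X) => //.
  by have [-> ->] := H a b aX bX ab; rewrite !eqxx.
by have [|-> ->] := H b a bX aX _; rewrite ?(adj_sym b) // !eqxx orbT.
Qed.

Hypothesis Gconn : connected_graph G.

Lemma connected_in_setT : connected_in [set: G].
Proof.
apply/connected_inP => x y _ _; have /forallP/(_ x)/forallP/(_ y) := Gconn.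
by apply: connect_sub => a b ab; apply: connect1; rewrite /edge_in /= !inE.
Qed.

Lemma closed_full X x y :
  (forall a b, a \in X -> adj a b -> b \in X) -> x \in X -> y \in X.
Proof.
move=> closedX xX; have /forallP/(_ x)/forallP/(_ y)/connectP[p pp ->] := Gconn.
elim: p x xX pp => //= b p IHp x xX /andP[xb]; exact: IHp (closedX _ _ xX xb).
Qed.

(** An edge leaving the intersection would be [pq] or [xy], but [p] is not in [Y] and [x] is not in
    [X]. A nonempty intersection would thus be closed under adjacency and, by connectedness, contain
    [p]. *)
Lemma cuts_disjoint X Y (p q x y : G) : cutT X p q -> cutT Y x y ->
  p \notin Y -> q \notin Y -> x \notin X -> y \notin X -> [disjoint X & Y].
Proof.
move=> cX cY pY qY xX yX; apply/pred0P => a /=; apply/negP => /andP[aX aY].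
have /cutTP[_ _ _ HX] := cX; have /cutTP[_ _ _ HY] := cY.
have : p \in X :&: Y.
  apply: (@closed_full _ a); last by rewrite inE aX.
  move=> c d; rewrite !inE => /andP[cinX cinY] cd; apply/andP; split.
    by apply/negPn/negP => dX; rewrite -(HX c d cinX dX cd).1 cinY in pY.
  by apply/negPn/negP => dY; rewrite -(HY c d cinY dY cd).1 cinX in xX.
by rewrite inE (negPf pY) andbF.
Qed.

Hypothesis delta_ge2 : 2 <= min_deg G.
Hypothesis sigma4_ge : geq_oo (sigma G 4) #|G|.

Lemma deg_ge2 x : 1 < deg x.
Proof.
apply: leq_trans delta_ge2 _; rewrite /min_deg.
elim: (index_enum _) (mem_index_enum x) => // z s IHs.
by rewrite inE big_cons geq_min => /predU1P[->|/IHs->]; rewrite ?leqnn ?orbT.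
Qed.

(** By the minimum degree, [x] has a neighbour other than [y]. It lies in [X] and differs from [x],
    the only vertex of [X] with a neighbour outside. *)
Lemma cutT_inner X x y : cutT X x y ->
  exists2 v, v \in X & forall b, adj v b -> b \in X.
Proof.
move=> /cutTP[xX yX xy H].
have /card_gt0P[v] : 0 < #|[set z | adj x z] :\ y|.
  by have := deg_ge2 x; rewrite /deg (cardsD1 y) inE xy.
rewrite !inE => /andP[vy xv]; exists v.
  by apply/negPn/negP => vX; rewrite (H x v xX vX xv).2 eqxx in vy.
move=> b vb; apply/negPn/negP => bX; have [|vx _] := H v b _ bX vb.
  by apply/negPn/negP => vX; rewrite (H x v xX vX xv).2 eqxx in vy.
by rewrite vx adj_irrefl in xv.
Qed.

(** The bound is strict because [x] belongs to [X] but is not its own neighbour. Each part thereby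
    saves one in the degree sum. *)
Lemma deg_lt X x (K : seq G) :
  x \in X -> (forall z, adj x z -> (z \in X) || (z \in K)) -> deg x < #|X| + size K.
Proof.
move=> xX H; rewrite (cardsD1 x X) xX add1n addSn ltnS.
apply: leq_trans (_ : #|(X :\ x) :|: [set z in K]| <= _).
  apply/subset_leq_card/subsetP => z; rewrite !inE => xz.
  by rewrite eq_sym adj_neq //= H.
apply: leq_trans (leq_card_setU _ _) _; rewrite leq_add2l cardsE; exact: card_size.
Qed.

(* K and L list the neighbours of b and d outside their own parts: since there
   are at most three of them, the degree sum is at most #|G| - 4 + 3. *)
Lemma four_parts A B X a b c d (K L : seq G) :
  [disjoint A & B] -> [disjoint A & X] -> [disjoint B & X] ->
  a \in A -> b \in B -> c \in X -> d \notin A :|: B :|: X ->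
  (forall z, adj a z -> z \in A) -> (forall z, adj c z -> z \in X) ->
  (forall z, adj b z -> (z \in B) || (z \in K)) ->
  (forall z, adj d z -> (z \in ~: (A :|: B :|: X)) || (z \in L)) ->
  ~~ adj b d -> size K + size L <= 3 -> False.
Proof.
move=> dAB dAX dBX aA bB cX dD Na Nc Nb Nd nbd KL.
have nab : ~~ adj a b by apply: contraL bB => /Na zA; rewrite (disjointFr dAB).
have nac : ~~ adj a c by apply: contraL cX => /Na zA; rewrite (disjointFr dAX).
have ncb : ~~ adj c b by apply: contraL bB => /Nc zX; rewrite (disjointFl dBX).
move: (dD); rewrite !in_setU !negb_or => /andP[/andP[dA dB] dX].
have nad : ~~ adj a d by apply: contra dA => /Na.
have ncd : ~~ adj c d by apply: contra dX => /Nc.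
have ab : a != b by apply: contraTneq bB => <-; rewrite (disjointFr dAB).
have ac : a != c by apply: contraTneq cX => <-; rewrite (disjointFr dAX).
have bc : b != c by apply: contraTneq cX => <-; rewrite (disjointFr dBX).
have ad : a != d by apply: contraNneq dA => <-.
have bd : b != d by apply: contraNneq dB => <-.
have cd : c != d by apply: contraNneq dX => <-.
pose S := [set a; b; c; d].
have /sigma_geP/(_ S) := sigma4_ge.
have -> : independent S.
  apply/forall_inP => x; rewrite !inE -!orbA => xS; apply/forall_inP => y.
  rewrite !inE -!orbA => yS.
  by case/or4P: xS => /eqP->; case/or4P: yS => /eqP->; rewrite ?adj_irrefl // adj_sym.
have cS : uniq [:: a; b; c; d].
  by rewrite /= !inE !negb_or ab ac ad bc bd cd.
have ES : S =i [:: a; b; c; d] by move=> z; rewrite !inE -!orbA.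
rewrite (eq_card ES) (card_uniqP cS) => /(_ isT erefl).
rewrite (eq_bigl _ _ ES) -big_uniq //= !big_cons big_nil addn0.
apply/negP; rewrite -ltnNge.
have dD' : d \in ~: (A :|: B :|: X) by rewrite inE.
have da : deg a < #|A| + 0 by apply: (@deg_lt A a [::] aA) => z /Na->.
have dc : deg c < #|X| + 0 by apply: (@deg_lt X c [::] cX) => z /Nc->.
have db := deg_lt bB Nb; have dd := deg_lt dD' Nd.
have cAB : #|A :|: B| = #|A| + #|B| by apply/eqP; rewrite (leq_card_setU A B).2.
have cABX : #|A :|: B :|: X| = #|A :|: B| + #|X|.
  apply/eqP; rewrite (leq_card_setU _ X).2 disjoint_sym.
  rewrite disjoints_subset setCU subsetI -!disjoints_subset.
  by rewrite ![[disjoint X & _]]disjoint_sym dAX.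
have := cardsC (A :|: B :|: X); rewrite cABX cAB.
move: KL da db dc dd; move: #|~: _| #|A| #|B| #|X| #|G| (size K) (size L).
move: (deg a) (deg b) (deg c) (deg d); clear => *; lia.
Qed.

(* The four vertices are interior vertices of A, B and X, and q. *)
Lemma star_impossible A B X (p q r x y : G) :
  cutT A p q -> cutT B r q -> cutT X x y ->
  [disjoint A & B] -> [disjoint A & X] -> [disjoint B & X] -> q \notin X -> False.
Proof.
move=> cA cB cX dAB dAX dBX qX.
have [a aA Na] := cutT_inner cA; have [b bB Nb] := cutT_inner cB.
have [c cinX Nc] := cutT_inner cX.
have /cutTP[_ qA _ HA] := cA; have /cutTP[_ qB _ HB] := cB.
have /cutTP[_ _ _ HX] := cX.
apply: (@four_parts A B X a b c q [::] [:: p; r; x]) => //.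
- by rewrite !inE !negb_or qA qB.
- by move=> z /Nb->.
- move=> z qz; rewrite !inE; have zq : adj z q by rewrite adj_sym.
  have [zA|zA] := boolP (z \in A); first by rewrite (HA z q zA qA zq).1 eqxx.
  have [zB|zB] := boolP (z \in B); first by rewrite (HB z q zB qB zq).1 eqxx !orbT.
  have [zX|zX] := boolP (z \in X); first by rewrite (HX z q zX qX zq).1 eqxx !orbT.
  by [].
- by apply/negP => /Nb bq; rewrite bq in qB.
Qed.

(* Removing the three bridges leaves the parts Y, A \ Y, the complement of A and
   B, and B, which form a path in this order. *)
Lemma chain_degrees A B Y (p q r x y : G) :
  cutT A p q -> cutT B r q -> cutT Y x y -> [disjoint A & B] -> p != r ->
  x \in A -> y \in A -> p \notin Y -> x != p ->
  [/\ y = p, forall z, adj p z -> z = x \/ z = q & forall z, adj q z -> z = p \/ z = r].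
Proof.
move=> cA cB cY dAB pr xA yA pY xp.
have /cutTP[pA qA pq HA] := cA; have /cutTP[rB qB rq HB] := cB.
have /cutTP[xY yY xy HY] := cY.
have side := cutT_side cY.
have qY : q \notin Y.
  rewrite -(side p q pq) //; apply: contraNN qA => /orP[]/andP[/eqP _ /eqP->] //.
have rY : r \notin Y.
  rewrite (side r q rq) //; apply: contraNN qA => /orP[]/andP[/eqP _ /eqP->] //.
have YA : Y \subset A.
  rewrite -[A]setCK -disjoints_subset disjoint_sym.
  by apply: cuts_disjoint (cutT_compl cA) cY _ _ _ _; rewrite // inE negbK.
pose P := A :\: Y.
have dYP : [disjoint Y & P].
  rewrite disjoint_sym disjoints_subset.
  by apply/subsetP => z; rewrite !inE => /andP[].
have dYB : [disjoint Y & B] by apply: disjointWl YA dAB.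
have dPB : [disjoint P & B] by apply: disjointWl (subsetDl _ _) dAB.
have YPB z : (z \in Y :|: P :|: B) = (z \in A) || (z \in B).
  rewrite !inE; case zY: (z \in Y) => //=; by rewrite (subsetP YA).
have [a aY Na] := cutT_inner cY; have [c cB' Nc] := cutT_inner cB.
have Nq z : adj q z -> (z \in ~: (Y :|: P :|: B)) || (z \in [:: p; r]).
  move=> qz; have zq : adj z q by rewrite adj_sym.
  rewrite in_setC YPB !inE negb_or.
  have [zA|zA] := boolP (z \in A); first by rewrite (HA z q zA qA zq).1 eqxx.
  have [zB|zB] := boolP (z \in B); first by rewrite (HB z q zB qB zq).1 eqxx orbT.
  by [].
(* A vertex of [P] other than [p] has at most the neighbour [x] outside [P], and [q] has at most [p]
   and [r] outside its part. With three outside neighbours in all, [four_parts] applies, so [P] is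
   reduced to [p]. *)
have P1 v : v \in P -> v = p.
  rewrite inE => /andP[vY vA]; apply/eqP/negPn/negP => vp.
  have nvq : ~~ adj v q by apply: contra vp => vq; rewrite (HA v q vA qA vq).1.
  apply: (@four_parts Y P B a v c q [:: x] [:: p; r]) => //.
  - by rewrite inE vY.
  - by rewrite YPB (negPf qA) (negPf qB).
  - move=> z vz; rewrite !inE; have [zA|zA] := boolP (z \in A); last first.
      by rewrite (HA v z vA zA vz).1 eqxx in vp.
    have [zY|//] := boolP (z \in Y).
    by rewrite [z](HY z v zY vY _).1 ?eqxx // adj_sym.
have yp : y = p by apply: P1; rewrite inE yY.
have Np z : adj p z -> z = x \/ z = q.
  move=> pz; have [zA|zA] := boolP (z \in A); last by right; have [] := HA p z pA zA pz.
  have [zY|zY] := boolP (z \in Y); first by left; rewrite (HY z p zY pY _).1 // adj_sym.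
  by move: pz; rewrite (P1 z) ?adj_irrefl // inE zY.
split=> // z qz.
have := Nq z qz; rewrite in_setC YPB !inE => /orP[zAB|/orP[]/eqP->]; [|by left|by right].
have zq : z != q by rewrite eq_sym adj_neq.
(* A further neighbour [z] of [q] lies in the part of [q] and has no neighbour outside it, while [p]
   has only [x] and [q] outside [P]. The total of outside neighbours is two. *)
case: (@four_parts Y P B a p c z [:: x; q] [::]) => //.
- by rewrite inE pY.
- by rewrite YPB.
- by move=> w /Np[]->; rewrite !inE eqxx ?orbT.
- move=> w zw; rewrite orbF in_setC YPB; move: zAB; rewrite !negb_or => /andP[zA zB].
  have wz : adj w z by rewrite adj_sym.
  apply/andP; split; apply/negP => wX.
    by rewrite (HA w z wX zA wz).2 eqxx in zq.
  by rewrite (HB w z wX zB wz).2 eqxx in zq.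
by apply/negP => /Np[] zE; [move: zAB; rewrite zE xA | rewrite zE eqxx in zq].
Qed.

Lemma same_edgeC u v a b : same_edge u v a b = same_edge a b u v.
Proof.
rewrite /same_edge /= !(eq_sym u) !(eq_sym v).
by rewrite [(b == u) && _]andbC.
Qed.

Lemma same_edge_swapl u v a b : same_edge u v a b = same_edge v u a b.
Proof. by rewrite /same_edge /= orbC. Qed.

Lemma same_edge_sym u v : symmetric (same_edge u v).
Proof. by move=> a b; rewrite same_edgeC same_edge_swapl same_edgeC. Qed.

(** The sides of the first two bridges away from [q] are disjoint. If [xy] lies in neither, the four
    parts form a star, which is impossible; otherwise they form a path, and [chain_degrees] shows
    that [uq] is its middle bridge. *)
Lemma third_bridge (p q r x y : G) :
  bridgeT p q -> bridgeT r q -> p != r -> bridgeT x y ->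
  ~~ same_edge p q x y -> ~~ same_edge r q x y ->
  exists t u, [/\ same_edge t u x y, (u == p) || (u == r),
    forall z, adj u z -> z = t \/ z = q & forall z, adj q z -> z = p \/ z = r].
Proof.
move=> /existsP[A cA] /existsP[B cB] pr /existsP[Y cY].
have /cutTP[pA qA pq HA] := cA; have /cutTP[rB qB rq HB] := cB.
have rA : r \notin A.
  by apply: contra pr => rA; rewrite (HA r q rA qA rq).1.
have pB : p \notin B.
  by apply: contra pr => pB; rewrite (HB p q pB qB pq).1.
have dAB := cuts_disjoint cA cB pB qB rA qA.
(* Complementing the cut exchanges [x] and [y], under which the claim is invariant; so [q] may be
   assumed to lie outside [Y]. *)
wlog qY : x y Y cY / q \notin Y => [H |] pqxy rqxy.
  have [qY|] := boolP (q \in Y); last by move/H; apply.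
  have [||//|t [u [s *]]] := H y x (~: Y) (cutT_compl cY).
  - by rewrite inE negbK.
  - by rewrite same_edge_sym.
  - by rewrite same_edge_sym.
  by exists t, u; rewrite same_edge_sym.
have /cutTP[xY yY xy HY] := cY.
have pY : p \notin Y by rewrite (cutT_side cY pq) // same_edgeC.
have rY : r \notin Y by rewrite (cutT_side cY rq) // same_edgeC.
have sA := cutT_side cA xy pqxy; have sB := cutT_side cB xy rqxy.
have [xA|xA] := boolP (x \in A).
  have xp : x != p by apply: contraNneq pY => <-.
  rewrite xA in sA.
  have [yp Np Nq] := chain_degrees cA cB cY dAB pr xA (esym sA) pY xp.
  by exists x, p; rewrite yp /same_edge /= !eqxx.
have [xB|xB] := boolP (x \in B).
  have xr : x != r by apply: contraNneq rY => <-.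
  rewrite xB in sB; rewrite disjoint_sym in dAB; rewrite eq_sym in pr.
  have [yr Nr Nq] := chain_degrees cB cA cY dAB pr xB (esym sB) rY xr.
  exists x, r; rewrite yr /same_edge /= !eqxx orbT; split=> // z /Nq[]; by [left|right].
rewrite (negPf xA) in sA; rewrite (negPf xB) in sB.
case: (star_impossible cA cB cY dAB _ _ qY).
  by apply: cuts_disjoint cA cY _ _ _ _; rewrite // -sA.
by apply: cuts_disjoint cB cY _ _ _ _; rewrite // -sB.
Qed.

(* A pair of adjacent bridges avoiding the middle edge of the path s p q r
   would contain sp, say, and the three bridges of the pair and qr would
   contradict [third_bridge]. *)
Lemma middle_bridge_half (s p q r y z : G) : bridgeT p q -> bridgeT r q ->
  p != r -> s != q ->
  (forall z, adj p z -> z = s \/ z = q) ->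
  bridgeT p y -> bridgeT z y -> p != z -> y != q -> False.
Proof.
move=> bpq brq pr sq Np bpy bzy pz yq.
have ys : y = s by case: (Np y (bridgeT_adj bpy)) => // yq'; rewrite yq' eqxx in yq.
subst y; have pq := bridgeT_adj bpq; have rq := bridgeT_adj brq.
have ps := bridgeT_adj bpy; have zs := bridgeT_adj bzy.
have [X cX] := existsP bpq; have /cutTP[pX qX _ _] := cX.
have sX : s \in X.
  by rewrite -(cutT_side cX ps) // /same_edge /= eqxx (negPf sq) (negPf (adj_neq pq)).
have zX : z \in X.
  rewrite (cutT_side cX zs) // /same_edge /= (negPf sq).
  by rewrite (eq_sym s p) (negPf (adj_neq ps)) !andbF.
have rX : r \notin X.
  rewrite (cutT_side cX rq) // /same_edge /= (eq_sym r p) (negPf pr).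
  by rewrite (eq_sym q p) (negPf (adj_neq pq)) andbF.
have sr : s != r by apply: contraTneq sX => ->.
(* Applied to the bridges [ps], [zs] and [rq], this makes [p] or [z] an end of [rq]. But [p] and [z]
   are in [X], whereas [r] and [q] are not. *)
have [t [u [tu uE _ _]]] : exists t u, [/\ same_edge t u r q, (u == p) || (u == z),
    forall w, adj u w -> w = t \/ w = s & forall w, adj s w -> w = p \/ w = z].
  by apply: third_bridge; rewrite // /same_edge /= negb_or !negb_and;
    rewrite ![_ == s]eq_sym sr sq orbT.
have uX : u \in X by case/orP: uE => /eqP->.
by case/orP: tu => /andP[/eqP E1 /eqP E2]; move: uX;
  rewrite -?E1 -?E2 ?(negPf qX) ?(negPf rX).
Qed.

(** If both bridges at [y] avoided [pq], then [third_bridge] applied to the three would make [x] or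
    [z] an end of [pq]. The half lemma excludes this, read along the path in one direction for [p]
    and in the other for [q]. *)
Lemma middle_bridge (s p q r x y z : G) : bridgeT s p -> bridgeT p q -> bridgeT r q ->
  p != r -> s != q ->
  (forall z, adj p z -> z = s \/ z = q) -> (forall z, adj q z -> z = p \/ z = r) ->
  bridgeT x y -> bridgeT z y -> x != z ->
  same_edge p q x y || same_edge p q z y.
Proof.
move=> bsp bpq brq pr sq Np Nq bxy bzy xz; apply/negPn/negP.
rewrite negb_or => /andP[nxy nzy].
have bqp : bridgeT q p by rewrite bridgeT_sym.
have Nq' w : adj q w -> w = r \/ w = p by case/Nq; [right|left].
have rp : r != p by rewrite eq_sym.
have qs : q != s by rewrite eq_sym.
have half w w' : bridgeT w y -> bridgeT w' y -> w != w' -> ~~ same_edge p q w y ->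
    (w == p) || (w == q) -> False.
  move=> bw bw' ww' nw /orP[]/eqP wE; subst w.
    apply: (middle_bridge_half bpq brq pr sq Np bw bw' ww').
    by apply: contraNneq nw => ->; rewrite /same_edge /= !eqxx.
  apply: (middle_bridge_half bqp bsp qs rp Nq' bw bw' ww').
  by apply: contraNneq nw => ->; rewrite /same_edge /= !eqxx orbT.
have [t [u [tu uE _ _]]] : exists t u, [/\ same_edge t u p q, (u == x) || (u == z),
    forall w, adj u w -> w = t \/ w = y & forall w, adj y w -> w = x \/ w = z].
  by apply: third_bridge; rewrite // same_edgeC.
have upq : (u == p) || (u == q).
  by case/orP: tu => /andP[/eqP E1 /eqP E2]; rewrite -?E1 -?E2 eqxx ?orbT.
case/orP: uE => /eqP uE; subst u; first exact: half bxy bzy xz nxy upq.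
by apply: half bzy bxy _ nzy upq; rewrite eq_sym.
Qed.

Lemma bridge_hitting_pairs (p q : G) : bridgeT p q ->
  exists2 ab, bridgeT ab.1 ab.2 & forall x y z, bridgeT x y -> bridgeT z y -> x != z ->
    same_edge ab.1 ab.2 x y || same_edge ab.1 ab.2 z y.
Proof.
move=> b0.
pose hits a b := [forall x, forall y, forall z, [&& bridgeT x y, bridgeT z y & x != z] ==>
  (same_edge a b x y || same_edge a b z y)].
have hitsP a b : reflect (forall x y z, bridgeT x y -> bridgeT z y -> x != z ->
    same_edge a b x y || same_edge a b z y) (hits a b).
  apply: (iffP forallP) => [H x y z xy zy xz | H x].
    have /forallP/(_ y)/forallP/(_ z)/implyP := H x; apply; exact/and3P.
  apply/forallP => y; apply/forallP => z; apply/implyP => /and3P[*]; exact: H.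
have [/existsP[a /existsP[b /andP[bab /hitsP H]]]|none] :=
    boolP [exists a, exists b, bridgeT a b && hits a b].
  by exists (a, b).
have miss a b : bridgeT a b -> exists x y z, [/\ bridgeT x y, bridgeT z y, x != z,
    ~~ same_edge a b x y & ~~ same_edge a b z y].
  move=> bab; have : ~~ hits a b.
    apply: contra none => h; apply/existsP; exists a; apply/existsP; exists b.
    by rewrite bab.
  case/forallPn => x /forallPn[y /forallPn[z]].
  rewrite negb_imply negb_or => /andP[/and3P[bxy bzy xz] /andP[nxy nzy]].
  by exists x, y, z.
(* From here on [pq] and [rq] are two adjacent bridges, missed by the bridge given at first. *)
have {p q b0} [p [q [r [bpq brq pr _ _]]]] := miss p q b0.
(* The pair missed by [pq] consists of two different bridges, so at least one of them also differs
   from [rq]. *)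
have [x [y [bxy pqxy rqxy]]] : exists x y,
    [/\ bridgeT x y, ~~ same_edge p q x y & ~~ same_edge r q x y].
  have [x [y [z [bxy bzy xz nxy nzy]]]] := miss p q bpq.
  have [xy|] := boolP (same_edge r q x y); last by exists x, y.
  exists z, y; split=> //; apply/negP => zy; move/negP: xz; apply; apply/eqP.
  by case/orP: xy => /andP[/eqP-> /eqP E];
    case/orP: zy => /andP[/eqP-> /eqP E']; rewrite -?E -?E' // E.
have [t [u [tu uE Nu Nq]]] := third_bridge bpq brq pr bxy pqxy rqxy.
have btu : bridgeT t u.
  by case/orP: tu => /andP[/eqP<- /eqP<-] //; rewrite bridgeT_sym.
(* The bridges now form a path whose middle edge is [pq] or [rq], and this middle edge meets every
   pair. *)
case/orP: uE => /eqP uE; subst u.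
  exists (p, q) => //= *; apply: (@middle_bridge t p q r) => //.
  apply: contraNneq pqxy => tq; move: tu; rewrite tq same_edge_swapl //.
exists (r, q) => //= *; apply: (@middle_bridge t r q p) => //.
- by rewrite eq_sym.
- by apply: contraNneq rqxy => tq; move: tu; rewrite tq same_edge_swapl.
by move=> w /Nq[]; [right|left].
Qed.

(** * The colouring *)

Lemma bridge_in_cut X (x y a b : G) : cutT X x y -> bridge X a b -> bridgeT a b.
Proof.
move=> /cutTP[_ _ _ H]; apply: (@bridge_attached _ X x) => //.
by move=> c d cX _ dX cd; have [-> _] := H c d cX dX cd.
Qed.

Lemma connected_in_cut X (x y : G) : cutT X x y -> connected_in X.
Proof.
move=> /cutTP[xX _ _ H]; apply: (@connected_attached [set: G] X x) => //.
  by move=> c d cX _ dX cd; have [-> _] := H c d cX dX cd.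
exact: connected_in_setT.
Qed.

(** Adjacent vertices need no marked edge, since a single edge is a conflict-free path under every
    colouring. *)
Definition near_or_route f :=
  forall x y, x != y -> adj x y \/ route [set: G] f 1 x y.

Lemma route_bridges_head S x y : route S (nonbridge S) 0 x y -> x != y ->
  exists2 z, bridge S x z & z = y \/ exists2 w, bridge S z w & x != w /\ w \in S.
Proof.
move=> [[|z p] /path_inP[pp lp up sp] cp]; first by rewrite -lp eqxx.
move: cp; rewrite /count_edges /= => /eqP; rewrite addn_eq0 eqb0 negbK => /andP[xz cp] _.
exists z => //; case: p pp lp up sp cp => [|w p] pp lp up sp; first by left.
rewrite /= addn_eq0 eqb0 negbK => /andP[zw _]; right; exists w => //; split.
  by apply: contraTneq up => ->; rewrite /= !inE eqxx orbT.
by apply: sp; rewrite !inE eqxx !orbT.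
Qed.

Lemma route_through_edge X Y f (x y a b : G) : [disjoint X & Y] ->
  adj a b -> f a b -> a \in X -> b \in Y ->
  route X f 0 x a -> route Y f 0 b y -> route [set: G] f 1 x y.
Proof.
move=> dXY ab fab aX bY r1 [q pq cq].
have vX v : v \in [set b] -> v \in Y by rewrite inE => /eqP->.
have r2 : route (a |: Y) f 1 a y.
  exists (b :: q); last by rewrite /count_edges /= fab -/(count_edges f b q) cq.
  apply: path_in_cons ab _ (path_in_sub (subsetUr _ _) pq); first by rewrite !inE eqxx.
  have [_ _ _ sq] := path_inP _ _ _ _ pq.
  by apply: contraTN aX => /sq aY; rewrite (disjointFl dXY).
apply: route_sub (subsetT _) (route_glue _ r1 r2) => c cX.
by rewrite !inE => /predU1P[//|cY]; rewrite (disjointFr dXY cX) in cY.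
Qed.

(** The bridge [ab] is marked along with a selection on each of its sides. Vertices on different
    sides are joined over [ab] by otherwise unmarked routes. On one side, a route of two or more
    bridges would begin with two adjacent bridges other than [ab], against [hit]; so its ends are
    adjacent. *)
Lemma two_colouring_of_bridge (a b : G) : bridgeT a b ->
  (forall x y z, bridgeT x y -> bridgeT z y -> x != z ->
    same_edge a b x y || same_edge a b z y) ->
  exists2 f, symmetric f & near_or_route f.
Proof.
move=> /existsP[X cX] hit; have /cutTP[aX bX ab HX] := cX.
have cX' := cutT_compl cX; set Y := ~: X in cX'.
have bY : b \in Y by rewrite inE.
have aY : a \notin Y by rewrite inE negbK.
have [f1 [sym1 sup1 zero1 one1]] := selection_exists (connected_in_cut cX).
have [f2 [sym2 sup2 zero2 one2]] := selection_exists (connected_in_cut cX').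
pose f := [rel x y | [|| f1 x y, f2 x y | same_edge a b x y]].
have notsame (C : {set G}) c d : (a \notin C) || (b \notin C) -> c \in C -> d \in C ->
    ~~ same_edge a b c d.
  move=> abC cC dC; apply: contraTN abC => /orP[]/andP[/eqP E1 /eqP E2];
  by rewrite -E1 -E2 cC dC.
have f1f : {in X &, forall c d, adj c d -> f1 c d = f c d}.
  move=> c d cX0 dX0 _; rewrite /f /= (negPf (notsame X c d _ cX0 dX0)) ?bX ?orbT // orbF.
  by case f2cd: (f2 c d); rewrite ?orbF //; have [] := sup2 _ _ f2cd; rewrite inE cX0.
have f2f : {in Y &, forall c d, adj c d -> f2 c d = f c d}.
  move=> c d cY dY _; rewrite /f /= (negPf (notsame Y c d _ cY dY)) ?aY // orbF.
  case f1cd: (f1 c d) => //; have [cX0 _] := sup1 _ _ f1cd.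
  by move: cY; rewrite inE cX0.
have piece (C : {set G}) g v w : cutT C v w -> (a \notin C) || (b \notin C) ->
    {in C &, forall c d, adj c d -> g c d = f c d} ->
    {in C &, forall x y, x != y -> route C g 1 x y \/ route C (nonbridge C) 0 x y} ->
    {in C &, forall x y, x != y -> adj x y \/ route [set: G] f 1 x y}.
  move=> cC abC gf one x y xC yC xy.
  have [r|r] := one x y xC yC xy.
    by right; apply: route_sub (subsetT _) (route_eq gf r).
  left; have [z xz [<-|[u zu [xu uC]]]] := route_bridges_head r xy.
    exact: bridgeT_adj (bridge_in_cut cC xz).
  have zC : z \in C by case/existsP: xz => Z /cutP[]; rewrite !inE => _ /andP[].
  have bzu := bridge_in_cut cC zu; rewrite bridgeT_sym in bzu.
  have := hit x z u (bridge_in_cut cC xz) bzu xu.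
  by rewrite (negPf (notsame C x z abC xC zC)) (negPf (notsame C u z abC uC zC)).
have dXY : [disjoint X & Y] by rewrite disjoints_subset setCK.
have symf : symmetric f by move=> c d; rewrite /f /= sym1 sym2 same_edge_sym.
exists f => // x y xy.
have z1 : {in X &, forall x y, route X f 0 x y}.
  by move=> c d cX0 dX0; apply: route_eq f1f (zero1 _ _ cX0 dX0).
have z2 : {in Y &, forall x y, route Y f 0 x y}.
  by move=> c d cY dY; apply: route_eq f2f (zero2 _ _ cY dY).
have fab : f a b by rewrite /f /same_edge /= !eqxx !orbT.
have [xX|xY] := boolP (x \in X); have [yX|yY] := boolP (y \in X).
- by apply: piece cX _ f1f one1 x y xX yX xy; rewrite bX orbT.
- right; apply: route_through_edge dXY ab fab aX bY (z1 _ _ xX aX) _.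
  by apply: z2; rewrite // inE.
- right; rewrite disjoint_sym in dXY; rewrite adj_sym in ab.
  have fba : f b a by rewrite /f /same_edge /= !eqxx !orbT.
  apply: route_through_edge dXY ab fba bY aX _ (z1 _ _ aX yX).
  by apply: z2; rewrite // inE.
- by apply: (piece Y f2 b a cX' _ f2f one2); rewrite ?aY // inE.
Qed.

Lemma two_colouring_exists : exists2 f, symmetric f & near_or_route f.
Proof.
have [/existsP[p /existsP[q bpq]]|nobr] := boolP [exists p, exists q, bridgeT p q].
  by have [[a b] bab hit] := bridge_hitting_pairs bpq; apply: two_colouring_of_bridge hit.
(* Without bridges a selection of the whole graph suffices: a nonempty route of bridges cannot
   exist. *)
have [f [symf _ _ one]] := selection_exists connected_in_setT.
exists f => // x y xy; right; have [//|r] := one x y (in_setT x) (in_setT y) xy.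
have [z xz _] := route_bridges_head r xy.
by case/negP: nobr; apply/existsP; exists x; apply/existsP; exists z.
Qed.

End Paths.

(** * From marked edges to colourings, and the lower bound *)

Section Colouring.
Variable G : sgraph.
Implicit Types (x y : G) (p : seq G) (f : rel G).

Definition second_colour f (w : {set G}) :=
  [exists x, exists y, (w == [set x; y]) && f x y].

Definition colouring_of f : {ffun edge G -> 'I_2} :=
  [ffun ed => if second_colour f (val ed) then ord_max else ord0].

Lemma second_colour_pair f x y : symmetric f -> second_colour f [set x; y] = f x y.
Proof.
move=> symf; apply/existsP/idP => [[a /existsP[b /andP[/eqP E fab]]]|fxy]; last first.
  by exists x; apply/existsP; exists y; rewrite eqxx.
have [Ex Ey] : (x == a) || (x == b) /\ (y == a) || (y == b).
  by have := set21 x y; have := set22 x y; rewrite E !inE.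
have [Ea Eb] : (a == x) || (a == y) /\ (b == x) || (b == y).
  by have := set21 a b; have := set22 a b; rewrite -E !inE.
move: Ex Ey Ea Eb => /orP[]/eqP-> /orP[]/eqP->; rewrite ?orbb.
- by move=> _ /eqP ba; rewrite ba in fab.
- by [].
- by rewrite symf.
- by move=> /eqP ab _; rewrite ab in fab.
Qed.

Lemma count_edges0_walk f x p w : symmetric f ->
  count_edges f x p = 0 -> w \in walk_edges x p -> ~~ second_colour f w.
Proof.
move=> symf; rewrite /count_edges /walk_edges; elim: p x => //= b p IHp x /eqP.
rewrite addn_eq0 eqb0 => /andP[nf /eqP cp]; rewrite inE => /predU1P[->|]; last exact: IHp.
by rewrite second_colour_pair.
Qed.

Lemma count_edges1 f x p : count_edges f x p = 1 -> exists p1 b p2,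
  [/\ p = p1 ++ b :: p2, f (last x p1) b,
      count_edges f x p1 = 0 & count_edges f b p2 = 0].
Proof.
rewrite /count_edges; elim: p x => //= b p IHp x.
case fxb: (f x b); first by case=> cp; exists [::], b, p.
rewrite add0n => /IHp[p1 [c [p2 [-> fc c1 c2]]]].
by exists (b :: p1), c, p2; rewrite /= fxb.
Qed.

Lemma set2_edge x y : adj x y -> [set x; y] \in edge_set G.
Proof. by move=> xy; apply/imsetP; exists (x, y); rewrite ?inE. Qed.

(** The colour [ord_max] is the witness: on the path only the single marked step has it. *)
Lemma conflict_free_route f x y p : symmetric f -> is_path x y p ->
  count_edges f x p = 1 -> conflict_free (colouring_of f) x p.
Proof.
move=> symf /and3P[pp _ _] /count_edges1[p1 [b [p2 [Ep fab c1 c2]]]].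
have ab : adj (last x p1) b by move: pp; rewrite Ep cat_path /= => /and3P[].
pose e0 : edge G := Sub [set last x p1; b] (set2_edge ab).
apply/existsP; exists ord_max; apply/cards1P; exists e0; apply/setP => ed.
rewrite !inE ffunE Ep /walk_edges pairmap_cat /= mem_cat inE.
rewrite -[pairmap _ x p1]/(walk_edges x p1) -[pairmap _ b p2]/(walk_edges b p2).
have [->|ned] := eqVneq ed e0.
  by rewrite /= eqxx orbT second_colour_pair // fab.
have /negPf-> : val ed != [set last x p1; b] by rewrite -[X in _ != X]/(val e0).
rewrite /=; case: ifPn => [red|_]; last by rewrite andbF.
rewrite andbT; apply/negP => /orP[]w.
  by have := count_edges0_walk symf c1 w; rewrite red.
by have := count_edges0_walk symf c2 w; rewrite red.
Qed.

Lemma conflict_free_edge k (c : {ffun edge G -> 'I_k}) x y :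
  adj x y -> conflict_free c x [:: y].
Proof.
move=> xy; pose e0 : edge G := Sub [set x; y] (set2_edge xy).
apply/existsP; exists (c e0); apply/cards1P; exists e0; apply/setP => ed.
rewrite !inE /= -[[set x; y]]/(val e0) (inj_eq val_inj).
by case: eqP => [->|]; rewrite ?eqxx.
Qed.

Lemma near_or_route_colourable f :
  symmetric f -> near_or_route f -> cf_colourable G 2.
Proof.
move=> symf H; apply/existsP; exists (colouring_of f); apply/cf_connectedP => x y xy.
have [a|[p /andP[pp _] cp]] := H x y xy; last first.
  by exists p => //; apply: conflict_free_route pp cp.
exists [:: y]; last exact: conflict_free_edge.
by rewrite /is_path /= a eqxx inE xy.
Qed.

(** A path between two nonadjacent vertices has at least two different edges; with only one colour
    they would share it, and no colour would appear exactly once. *)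
Lemma cf_colourable_ge2 k : ~~ complete_graph G -> cf_colourable G k -> 1 < k.
Proof.
move=> /forallPn[x /forallPn[y]]; rewrite negb_imply => /andP[xy nxy].
move=> /existsP[c /cf_connectedP/(_ x y xy)[[|z [|w p]] /and3P[pp /eqP lp up]]].
- by rewrite -lp eqxx in xy.
- by move: pp nxy; rewrite -lp /= => /andP[->].
case/existsP => a; rewrite ltnNge; apply: contraL => k1.
have one (i j : 'I_k) : i = j.
  by apply: val_inj; move: (valP i) (valP j) => /=; clear -k1; lia.
case/and3P: pp => xz zw _.
pose e1 : edge G := Sub [set x; z] (set2_edge xz).
pose e2 : edge G := Sub [set z; w] (set2_edge zw).
have e12 : e1 != e2.
  apply: contraTneq up => /(congr1 val) /= E; have := set21 x z.
  by rewrite E !inE orbA => /orP[/eqP->|/eqP->]; rewrite eqxx ?orbT.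
rewrite neq_ltn; apply/orP; right; apply: leq_trans (_ : #|[set e1; e2]| <= _).
  by rewrite cards2 e12.
apply/subset_leq_card/subsetP => ed; rewrite !inE (one (c ed) a) eqxx andbT.
by case/orP => /eqP->; rewrite /= eqxx ?orbT.
Qed.

End Colouring.

Theorem theorem6 (n : nat) (hn : 9 <= n) (G : sgraph) (order_G : #|G| = n)
  (Gconn : connected_graph G) (Gncompl : ~~ complete_graph G)
  (delta_ge2 : 2 <= min_deg G) (sigma4_ge : geq_oo (sigma G 4) n) :
  cfc Gconn = 2.
Proof.
rewrite -order_G in sigma4_ge.
have [f symf H] := two_colouring_exists Gconn delta_ge2 sigma4_ge.
have col2 := near_or_route_colourable symf H.
rewrite /cfc; case: ex_minnP => m colm minm; apply/eqP.
by rewrite eqn_leq minm // (cf_colourable_ge2 Gncompl colm).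
Qed.
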